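(* For $R>1$ and a hyperbolic conjugacy class $[f]$ in $\mathrm{PSL}(2,\mathbb{Z})$, let $m_f(R)=\#\{[f']\in\mathcal{H}:\lambda(f')<R,\ l_{\mathcal{C}}(f')=l_{\mathcal{C}}(f)\}$. Then for every positive integer $k$, \[\lim_{R\to\infty}\frac{\#\{[f]\in\mathcal{H}:\lambda(f)<R,\ m_f(R)\ge k\}}{\#\{[f]\in\mathcal{H}:\lambda(f)<R\}}=1.\]
   Context: $\mathcal{H}$ denotes the set of conjugacy classes of hyperbolic elements of $\mathrm{PSL}(2,\mathbb{Z})$ (elements with $|\operatorname{tr}|>2$). For hyperbolic $f$, $\lambda(f)>1$ is its dilatation, the largest absolute value of an eigenvalue of a matrix representing $f$ (a conjugacy invariant). The Farey graph has vertex set $\mathbb{Q}\cup\{\infty\}$, $p/q$ and $r/s$ adjacent iff $|ps-qr|=1$, path metric $d_{\mathcal{C}}$ with unit edges; $f$ acts by $p/q\mapsto(ap+bq)/(cp+dq)$, and $l_{\mathcal{C}}(f)=\liminf_{j\to\infty}d_{\mathcal{C}}(v,f^jv)/j$ (for any vertex $v$) is its stable translation length, a conjugacy invariant. *)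

(* Defs.v *)
From Stdlib Require Import Reals ZArith List ClassicalEpsilon.
Open Scope R_scope.

Record M2 := mkM2 { ma : Z; mb : Z; mc : Z; md : Z }.

Definition mmul (f g : M2) : M2 :=
  mkM2 (ma f * ma g + mb f * mc g)%Z (ma f * mb g + mb f * md g)%Z
       (mc f * ma g + md f * mc g)%Z (mc f * mb g + md f * md g)%Z.

Definition mid : M2 := mkM2 1 0 0 1.
Definition mneg (f : M2) : M2 := mkM2 (- ma f) (- mb f) (- mc f) (- md f).

Fixpoint mpow (f : M2) (j : nat) : M2 :=
  match j with O => mid | S j' => mmul f (mpow f j') end.

Definition SL2Z (f : M2) : Prop := (ma f * md f - mb f * mc f = 1)%Z.

Definition mtr (f : M2) : Z := (ma f + md f)%Z.

Definition psl_conj (f f' : M2) : Prop :=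
  exists g h : M2, SL2Z g /\ mmul g h = mid /\ mmul h g = mid /\
    (mmul (mmul g f) h = f' \/ mmul (mmul g f) h = mneg f').

Definition hyperbolic (f : M2) : Prop := (Z.abs (mtr f) > 2)%Z.

(* dilatation: largest absolute value of an eigenvalue, i.e. the largest
   |root| of x^2 - tr(f) x + 1 (for hyperbolic f) *)
Definition dilatation (f : M2) : R :=
  (IZR (Z.abs (mtr f)) + sqrt (IZR (mtr f * mtr f - 4))) / 2.

(* Farey graph: a vertex p/q is a primitive pair (p,q), up to sign;
   infinity = (1,0). *)
Definition vtx := (Z * Z)%type.
Definition farey_adj (u v : vtx) : Prop :=
  Z.abs (fst u * snd v - snd u * fst v) = 1%Z.
Definition same_vtx (u v : vtx) : Prop :=
  v = u \/ v = (- fst u, - snd u)%Z.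

Inductive fpath : vtx -> vtx -> nat -> Prop :=
| fpath0 : forall u v, same_vtx u v -> fpath u v 0
| fpathS : forall u w v n, farey_adj u w -> fpath w v n -> fpath u v (S n).

Definition farey_dist (u v : vtx) : nat :=
  epsilon (inhabits 0%nat)
    (fun n => fpath u v n /\ forall m, fpath u v m -> (n <= m)%nat).

Definition act (f : M2) (v : vtx) : vtx :=
  (ma f * fst v + mb f * snd v, mc f * fst v + md f * snd v)%Z.

Definition v_infty : vtx := (1%Z, 0%Z).

Definition is_liminf (u : nat -> R) (l : R) : Prop :=
  (forall eps, eps > 0 -> exists N, forall j, (j >= N)%nat -> l - eps < u j) /\
  (forall eps, eps > 0 -> forall N, exists j, (j >= N)%nat /\ u j < l + eps).

Definition liminf (u : nat -> R) : R := epsilon (inhabits 0) (is_liminf u).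

Definition lC (f : M2) : R :=
  liminf (fun j => INR (farey_dist v_infty (act (mpow f j) v_infty)) / INR j).

(* N = number of PSL(2,Z)-conjugacy classes of elements of SL(2,Z)
   satisfying P (P is a conjugacy-invariant property) *)
Definition is_class_count (P : M2 -> Prop) (N : nat) : Prop :=
  exists L : list M2, length L = N /\
    (forall x, In x L -> SL2Z x /\ P x) /\
    (forall i j, (i < N)%nat -> (j < N)%nat -> i <> j ->
        ~ psl_conj (nth i L mid) (nth j L mid)) /\
    (forall x, SL2Z x -> P x -> exists y, In y L /\ psl_conj x y).

Definition class_count (P : M2 -> Prop) : nat :=
  epsilon (inhabits 0%nat) (is_class_count P).

Definition m_f (f : M2) (R0 : R) : nat :=
  class_count (fun f' => hyperbolic f' /\ dilatation f' < R0 /\ lC f' = lC f).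

(* Main.v *)
Require Import Defs.
From Stdlib Require Import Reals ZArith List ClassicalEpsilon.
From Stdlib Require Import Lia Lra Classical.
Open Scope R_scope.

(** A class with [m_f < k] shares its value of [lC] with fewer than [k] classes, so there are at
    most [k] times as many such classes as values of [lC]; it suffices that values are rare.
    Every hyperbolic class has a representative [f] with nonnegative entries (reduction of the
    binary form of [f]).  The edge {0, oo} separates the Farey graph, and [f] maps it to its
    nonnegative side, so distances along the orbit of this edge are min-plus powers of a 2x2
    matrix of naturals; the growth rate of these is a minimal cycle mean, hence [2 * lC f] is an
    integer.  It is at most twice the distance from oo to [f oo], which is O(log R) by
    nearest-integer continued fractions, whereas distinct traces already give about R classes. *)

(** * Matrix algebra and conjugacy in PSL(2,Z) *)

Lemma M2_eq (a b c d a' b' c' d' : Z) :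
  a = a' -> b = b' -> c = c' -> d = d' -> mkM2 a b c d = mkM2 a' b' c' d'.
Proof. intros; subst; reflexivity. Qed.

Lemma mmul_assoc f g h : mmul (mmul f g) h = mmul f (mmul g h).
Proof. unfold mmul; cbn [ma mb mc md]; apply M2_eq; ring. Qed.

Lemma mmul_id_l f : mmul mid f = f.
Proof. destruct f as [a b c d]; unfold mmul, mid; cbn [ma mb mc md]; apply M2_eq; ring. Qed.

Lemma mmul_id_r f : mmul f mid = f.
Proof. destruct f as [a b c d]; unfold mmul, mid; cbn [ma mb mc md]; apply M2_eq; ring. Qed.

Lemma mmul_mneg_l f g : mmul (mneg f) g = mneg (mmul f g).
Proof. unfold mmul, mneg; cbn [ma mb mc md]; apply M2_eq; ring. Qed.

Lemma mmul_mneg_r f g : mmul f (mneg g) = mneg (mmul f g).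
Proof. unfold mmul, mneg; cbn [ma mb mc md]; apply M2_eq; ring. Qed.

Lemma mneg_involutive f : mneg (mneg f) = f.
Proof. destruct f as [a b c d]; unfold mneg; cbn [ma mb mc md]; apply M2_eq; ring. Qed.

Lemma det_mmul f g :
  (ma (mmul f g) * md (mmul f g) - mb (mmul f g) * mc (mmul f g) =
   (ma f * md f - mb f * mc f) * (ma g * md g - mb g * mc g))%Z.
Proof. unfold mmul; cbn [ma mb mc md]; ring. Qed.

Lemma SL2Z_mmul f g : SL2Z f -> SL2Z g -> SL2Z (mmul f g).
Proof. unfold SL2Z; intros Hf Hg; rewrite det_mmul, Hf, Hg; reflexivity. Qed.

Lemma SL2Z_right_inverse g h : SL2Z g -> mmul g h = mid -> SL2Z h.
Proof.
  unfold SL2Z; intros Hg E; pose proof (det_mmul g h) as D.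
  rewrite E, Hg in D; unfold mid in D; cbn [ma mb mc md] in D; lia.
Qed.

Lemma mtr_mmulC f g : mtr (mmul f g) = mtr (mmul g f).
Proof. unfold mtr, mmul; cbn [ma mb mc md]; ring. Qed.

Lemma psl_conj_refl f : psl_conj f f.
Proof.
  exists mid, mid; split; [reflexivity |].
  do 2 (split; [apply mmul_id_l |]).
  left; rewrite mmul_id_r; apply mmul_id_l.
Qed.

Lemma psl_conj_sym f f' : psl_conj f f' -> psl_conj f' f.
Proof.
  intros (g & h & Hg & gh & hg & E); exists h, g; split.
  { exact (SL2Z_right_inverse g h Hg gh). }
  split; [exact hg | split; [exact gh |]].
  assert (F : mmul (mmul h (mmul (mmul g f) h)) g = f).
  { rewrite !mmul_assoc, hg, mmul_id_r, <- mmul_assoc, hg; apply mmul_id_l. }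
  destruct E as [E | E]; rewrite E in F; [left; exact F | right].
  rewrite mmul_mneg_r, mmul_mneg_l in F.
  rewrite <- F, mneg_involutive; reflexivity.
Qed.

Lemma psl_conj_trans f1 f2 f3 : psl_conj f1 f2 -> psl_conj f2 f3 -> psl_conj f1 f3.
Proof.
  intros (g & h & Hg & gh & hg & E) (g' & h' & Hg' & gh' & hg' & E').
  exists (mmul g' g), (mmul h h').
  split; [apply SL2Z_mmul; assumption |].
  split; [rewrite mmul_assoc, <- (mmul_assoc g h h'), gh, mmul_id_l; exact gh' |].
  split; [rewrite mmul_assoc, <- (mmul_assoc h' g' g), hg', mmul_id_l; exact hg |].
  assert (F : mmul (mmul (mmul g' g) f1) (mmul h h') =
              mmul (mmul g' (mmul (mmul g f1) h)) h').
  { rewrite !mmul_assoc; reflexivity. }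
  rewrite F; destruct E as [E | E]; rewrite E; [exact E' |].
  rewrite mmul_mneg_r, mmul_mneg_l.
  destruct E' as [E' | E']; rewrite E'; [right | left]; auto using mneg_involutive.
Qed.

Lemma psl_conj_abs_mtr f f' : psl_conj f f' -> Z.abs (mtr f') = Z.abs (mtr f).
Proof.
  intros (g & h & _ & _ & hg & E).
  assert (F : mtr (mmul (mmul g f) h) = mtr f).
  { rewrite mtr_mmulC, <- mmul_assoc, hg, mmul_id_l; reflexivity. }
  destruct E as [E | E]; rewrite E in F; [rewrite F; reflexivity |].
  unfold mtr, mneg in *; simpl in F; lia.
Qed.

Lemma psl_conj_hyperbolic f f' : psl_conj f f' -> hyperbolic f -> hyperbolic f'.
Proof. unfold hyperbolic; intros C; rewrite (psl_conj_abs_mtr f f' C); auto. Qed.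

Lemma psl_conj_dilatation f f' : psl_conj f f' -> dilatation f' = dilatation f.
Proof.
  intros C; pose proof (psl_conj_abs_mtr f f' C) as E; unfold dilatation.
  rewrite <- (Z.abs_square (mtr f')), <- (Z.abs_square (mtr f)), E; reflexivity.
Qed.

Lemma psl_conj_SL2Z f f' : psl_conj f f' -> SL2Z f -> SL2Z f'.
Proof.
  intros (g & h & Hg & gh & _ & E) Hf.
  assert (D : SL2Z (mmul (mmul g f) h)).
  { apply SL2Z_mmul; [apply SL2Z_mmul; assumption |].
    exact (SL2Z_right_inverse g h Hg gh). }
  destruct E as [E | E]; rewrite E in D; [exact D |].
  unfold SL2Z, mneg in *; simpl in D; lia.
Qed.

(** * Reduction theory: nonnegative representatives of hyperbolic classes *)

(** Conjugation by the translation z -> z + e, which keeps the entry c; [lower_conj] is its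
    transpose analogue and keeps b. *)
Definition upper_conj (e : Z) (f : M2) : M2 :=
  mkM2 (ma f + e * mc f) (mb f + e * (md f - ma f) - e * e * mc f)
       (mc f) (md f - e * mc f).

Definition lower_conj (e : Z) (f : M2) : M2 :=
  mkM2 (ma f - e * mb f) (mb f)
       (mc f + e * (ma f - md f) - e * e * mb f) (md f + e * mb f).

Lemma psl_conj_upper e f : psl_conj f (upper_conj e f).
Proof.
  exists (mkM2 1 e 0 1), (mkM2 1 (- e) 0 1).
  unfold SL2Z, mmul, mid, upper_conj; cbn [ma mb mc md].
  repeat split; try (apply M2_eq; ring); try ring.
  left; apply M2_eq; ring.
Qed.

Lemma psl_conj_lower e f : psl_conj f (lower_conj e f).
Proof.
  exists (mkM2 1 0 e 1), (mkM2 1 0 (- e) 1).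
  unfold SL2Z, mmul, mid, lower_conj; cbn [ma mb mc md].
  repeat split; try (apply M2_eq; ring); try ring.
  left; apply M2_eq; ring.
Qed.

Lemma psl_conj_rotate f : psl_conj f (mkM2 (md f) (- mc f) (- mb f) (ma f)).
Proof.
  exists (mkM2 0 1 (-1) 0), (mkM2 0 (-1) 1 0).
  unfold SL2Z, mmul, mid; cbn [ma mb mc md]; repeat split; try (apply M2_eq; ring).
  left; apply M2_eq; ring.
Qed.

Lemma psl_conj_mneg f : psl_conj f (mneg f).
Proof.
  exists mid, mid; split; [reflexivity |].
  do 2 (split; [apply mmul_id_l |]).
  right; rewrite mmul_id_r, mmul_id_l, mneg_involutive; reflexivity.
Qed.

(** For determinant 1 this quantity, the discriminant of the fixed-point equation c z^2 + (d - a) z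
    - b = 0, equals tr^2 - 4. *)
Lemma hyperbolic_disc_pos f :
  SL2Z f -> hyperbolic f -> ((md f - ma f) * (md f - ma f) + 4 * (mb f * mc f) > 0)%Z.
Proof. unfold SL2Z, hyperbolic, mtr; intros; nia. Qed.

Lemma hyperbolic_bc_neq0 f : SL2Z f -> hyperbolic f -> (mb f * mc f <> 0)%Z.
Proof.
  unfold SL2Z, hyperbolic, mtr; intros Hd Ht E.
  assert (A : (ma f * md f = 1)%Z) by lia.
  apply Z.mul_eq_1 in A as A'; destruct A' as [A' | A']; rewrite A' in *; lia.
Qed.

(* The discriminant condition D^2 > 4 E c with E >= c forces D > 2 c, so that E + c - D < E. *)
Lemma reduction_inequality (b c D : Z) :
  (b * c < 0)%Z -> (Z.abs c <= Z.abs b)%Z -> (D * D + 4 * (b * c) > 0)%Z ->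
  exists e, let b' := (b + e * D - e * e * c)%Z in
    (b' * c >= 0)%Z \/ (Z.abs b' < Z.abs b)%Z.
Proof.
  (* With this choice the new entry is sgn(c) (|D| - |c| - |b|): either it no longer has the sign
     opposite to c, or its absolute value has dropped by |D| - |c| > 0. *)
  intros Hbc Hle HD; exists (Z.sgn c * Z.sgn D)%Z; simpl.
  assert (H2 : (Z.abs D > 2 * Z.abs c)%Z) by nia.
  destruct (Z.lt_trichotomy c 0) as [Hc | [Hc | Hc]]; [| nia |];
  destruct (Z.lt_trichotomy D 0) as [Hd | [Hd | Hd]]; try lia;
  repeat rewrite ?(Z.sgn_neg c), ?(Z.sgn_pos c), ?(Z.sgn_neg D), ?(Z.sgn_pos D) by lia;
  (match goal with |- ((?x * _ >= 0)%Z \/ _) => set (b' := x) end);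
  assert (Hb : (b < 0 \/ b > 0)%Z) by nia;
  destruct Hb as [Hb | Hb]; try nia;
  (destruct (Z_le_gt_dec 0 b') as [Q | Q]; subst b'; (try (left; nia)); right; lia).
Qed.

(** Descent on |b| + |c|: while bc < 0, a unit translation shrinks the larger off-diagonal entry or
    makes bc >= 0, and bc = 0 is impossible for a hyperbolic element. *)
Lemma hyperbolic_conj_bc_pos n f :
  SL2Z f -> hyperbolic f -> (Z.abs (mb f) + Z.abs (mc f) < Z.of_nat n)%Z ->
  exists f', psl_conj f f' /\ (mb f' * mc f' > 0)%Z.
Proof.
  revert f; induction n as [| n IH]; intros f Hf Hh Hn; [lia |].
  pose proof (hyperbolic_disc_pos f Hf Hh) as HD.
  pose proof (hyperbolic_bc_neq0 f Hf Hh) as H0.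
  assert (step : forall f', psl_conj f f' ->
    (mb f' * mc f' >= 0)%Z \/
    (Z.abs (mb f') + Z.abs (mc f') < Z.abs (mb f) + Z.abs (mc f))%Z ->
    exists f'', psl_conj f f'' /\ (mb f'' * mc f'' > 0)%Z).
  { intros f' C Hlt.
    pose proof (psl_conj_SL2Z f f' C Hf) as Hf'.
    pose proof (psl_conj_hyperbolic f f' C Hh) as Hh'.
    pose proof (hyperbolic_bc_neq0 f' Hf' Hh').
    destruct Hlt as [Hlt | Hlt]; [exists f'; split; [exact C | lia] |].
    destruct (IH f' Hf' Hh') as (f'' & C' & P); [lia |].
    exists f''; split; [exact (psl_conj_trans _ _ _ C C') | exact P]. }
  destruct (Z_lt_le_dec (mb f * mc f) 0) as [Hneg | Hpos].
  2: { exists f; split; [apply psl_conj_refl | lia]. }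
  destruct (Z_le_gt_dec (Z.abs (mc f)) (Z.abs (mb f))) as [Hle | Hgt].
  - destruct (reduction_inequality (mb f) (mc f) (md f - ma f)) as [e He]; auto.
    apply (step (upper_conj e f) (psl_conj_upper e f)).
    cbv zeta in He; unfold upper_conj; cbn [mb mc].
    destruct He; [left; assumption | right; lia].
  - destruct (reduction_inequality (mc f) (mb f) (ma f - md f)) as [e He]; try nia.
    apply (step (lower_conj e f) (psl_conj_lower e f)).
    cbv zeta in He; unfold lower_conj; cbn [mb mc].
    destruct He; [left; lia | right; lia].
Qed.

Lemma mul_pos_same_sign (x y : Z) : (x * y > 0 -> x > 0 /\ y > 0 \/ x < 0 /\ y < 0)%Z.
Proof. destruct (Z.lt_trichotomy x 0) as [H | [-> | H]]; intros E; [right | | left]; nia. Qed.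

Definition nonneg (f : M2) : Prop :=
  (0 <= ma f /\ 0 <= mb f /\ 0 <= mc f /\ 0 <= md f)%Z.

(** Once bc > 0, also ad = 1 + bc > 0, so the diagonal has one sign and the off-diagonal has one
    sign. The rotation of order two flips the off-diagonal signs and [mneg] flips all signs, which
    covers the four patterns. *)
Lemma hyperbolic_conj_nonneg f :
  SL2Z f -> hyperbolic f -> exists f', psl_conj f f' /\ nonneg f'.
Proof.
  intros Hf Hh.
  destruct (hyperbolic_conj_bc_pos
    (S (Z.to_nat (Z.abs (mb f) + Z.abs (mc f)))) f Hf Hh) as (f1 & C & P); [lia |].
  pose proof (psl_conj_SL2Z f f1 C Hf) as Hf1.
  unfold SL2Z in Hf1.
  assert (Q : (ma f1 * md f1 > 0)%Z) by lia.
  assert (A : (ma f1 > 0 /\ md f1 > 0 \/ ma f1 < 0 /\ md f1 < 0)%Z)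
    by (apply mul_pos_same_sign; exact Q).
  assert (B : (mb f1 > 0 /\ mc f1 > 0 \/ mb f1 < 0 /\ mc f1 < 0)%Z)
    by (apply mul_pos_same_sign; exact P).
  set (r := mkM2 (md f1) (- mc f1) (- mb f1) (ma f1)).
  assert (Cr : psl_conj f r) by exact (psl_conj_trans _ _ _ C (psl_conj_rotate f1)).
  destruct A, B.
  - exists f1; split; [exact C | unfold nonneg; lia].
  - exists r; split; [exact Cr | unfold nonneg; simpl; lia].
  - exists (mneg r); split; [exact (psl_conj_trans _ _ _ Cr (psl_conj_mneg r)) |].
    unfold nonneg; simpl; lia.
  - exists (mneg f1); split; [exact (psl_conj_trans _ _ _ C (psl_conj_mneg f1)) |].
    unfold nonneg; simpl; lia.
Qed.

(** * Paths in the Farey graph and the action on them *)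

Lemma farey_adj_sym u v : farey_adj u v -> farey_adj v u.
Proof. unfold farey_adj; lia. Qed.

Lemma same_vtx_sym u v : same_vtx u v -> same_vtx v u.
Proof.
  destruct u as [p q], v as [r s]; unfold same_vtx; simpl.
  intros [E | E]; injection E as -> ->; [left | right]; f_equal; ring.
Qed.

Lemma same_vtx_trans u v w : same_vtx u v -> same_vtx v w -> same_vtx u w.
Proof.
  destruct u as [p q], v as [r s], w as [x y]; unfold same_vtx; simpl.
  intros [E | E] [F | F]; injection E as -> ->; injection F as -> ->;
    [left | right | right | left]; f_equal; ring.
Qed.

Lemma farey_adj_same_vtx_l u v w : same_vtx u v -> farey_adj v w -> farey_adj u w.
Proof.
  destruct u as [p q], v as [r s]; unfold same_vtx, farey_adj; simpl.
  intros [E | E]; injection E as -> ->; lia.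
Qed.

(** A path reaches its end only up to sign, so gluing two paths requires a change of representative
    at the junction. *)
Lemma fpath_same_vtx_l u v w n : same_vtx u v -> fpath v w n -> fpath u w n.
Proof.
  intros S H; destruct H as [v w H | v x w n A H].
  - apply fpath0; exact (same_vtx_trans _ _ _ S H).
  - apply fpathS with x; [exact (farey_adj_same_vtx_l _ _ _ S A) | exact H].
Qed.

Lemma fpath_cat u v w m n : fpath u v m -> fpath v w n -> fpath u w (m + n).
Proof.
  induction 1 as [u v S | u x v m A H IH]; intros K; simpl.
  - exact (fpath_same_vtx_l _ _ _ _ S K).
  - apply fpathS with x; auto.
Qed.

Lemma fpath_adj u v : farey_adj u v -> fpath u v 1.
Proof. intros A; apply fpathS with v; [exact A | apply fpath0; left; reflexivity]. Qed.

Lemma act_same_vtx f u v : same_vtx u v -> same_vtx (act f u) (act f v).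
Proof.
  unfold same_vtx; intros [-> | ->]; [left; reflexivity | right].
  unfold act; simpl; f_equal; ring.
Qed.

Lemma act_farey_adj f u v : SL2Z f -> farey_adj u v -> farey_adj (act f u) (act f v).
Proof.
  unfold SL2Z, farey_adj, act; simpl; intros Hf.
  match goal with |- _ -> Z.abs ?x = _ =>
    replace x with ((ma f * md f - mb f * mc f) *
      (fst u * snd v - snd u * fst v))%Z by ring end.
  rewrite Hf, Z.mul_1_l; auto.
Qed.

Lemma act_fpath f u v n : SL2Z f -> fpath u v n -> fpath (act f u) (act f v) n.
Proof.
  intros Hf; induction 1 as [u v S | u x v n A H IH].
  - apply fpath0, act_same_vtx, S.
  - apply fpathS with (act f x); [apply act_farey_adj; assumption | exact IH].
Qed.

Lemma act_mmul f g v : act (mmul f g) v = act f (act g v).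
Proof. unfold act, mmul; simpl; f_equal; ring. Qed.

Lemma act_mid v : act mid v = v.
Proof. destruct v; unfold act, mid; cbn [ma mb mc md fst snd]; f_equal; ring. Qed.

(** [farey_dist] is an [epsilon] choice, so nothing is known about it until some path is
    exhibited. *)
Lemma farey_dist_spec u v n : fpath u v n ->
  fpath u v (farey_dist u v) /\ (forall m, fpath u v m -> (farey_dist u v <= m)%nat).
Proof.
  intros H; unfold farey_dist; apply epsilon_spec.
  destruct (dec_inh_nat_subset_has_unique_least_element (fpath u v)) as (m & [P _]).
  - intros j; apply classic.
  - exists n; exact H.
  - exists m; exact P.
Qed.

(** * The separating edge {oo, 0} *)

Definition v_zero : vtx := (0%Z, 1%Z).

(** Type [vtx] contains imprimitive pairs such as (2,0); having a neighbour forces primitivity. *)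
Lemma adj_axis_vertex u w :
  farey_adj u w -> (fst u * snd u = 0)%Z -> same_vtx u v_infty \/ same_vtx u v_zero.
Proof.
  destruct u as [p q], w as [r s]; unfold farey_adj, same_vtx, v_infty, v_zero; simpl.
  intros A E; apply Z.mul_eq_0 in E; destruct E as [-> | ->].
  - right; assert (B : (Z.abs q * Z.abs r = 1)%Z) by (rewrite <- Z.abs_mul; lia).
    apply Z.mul_eq_1 in B; assert (Q : (q = 1 \/ q = -1)%Z) by lia.
    destruct Q as [-> | ->]; auto.
  - left; assert (B : (Z.abs p * Z.abs s = 1)%Z) by (rewrite <- Z.abs_mul; lia).
    apply Z.mul_eq_1 in B; assert (Q : (p = 1 \/ p = -1)%Z) by lia.
    destruct Q as [-> | ->]; auto.
Qed.

(* The edge {oo, 0} separates the Farey graph: for pq < 0 < rs the determinant ps - qr has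
   absolute value |ps| + |qr| >= 2. *)
Lemma fpath_split u v n :
  fpath u v n -> (exists w, farey_adj u w) ->
  (fst u * snd u <= 0)%Z -> (0 <= fst v * snd v)%Z ->
  exists c n1 n2, (c = v_infty \/ c = v_zero) /\ (n = n1 + n2)%nat /\
    fpath u c n1 /\ fpath c v n2.
Proof.
  assert (at_edge : forall u v w n, fpath u v n -> farey_adj u w ->
    (fst u * snd u = 0)%Z -> exists c n1 n2, (c = v_infty \/ c = v_zero) /\
      (n = n1 + n2)%nat /\ fpath u c n1 /\ fpath c v n2).
  { clear; intros u v w n P A E.
    assert (H : exists c, (c = v_infty \/ c = v_zero) /\ same_vtx u c).
    { destruct (adj_axis_vertex u w A E); eauto. }
    destruct H as (c & Hc & S); exists c, 0%nat, n; repeat split; [exact Hc | |].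
    - exact (fpath0 _ _ S).
    - exact (fpath_same_vtx_l _ _ _ _ (same_vtx_sym _ _ S) P). }
  induction 1 as [u v S | u x v n A H IH]; intros [w Hw] Hu Hv.
  - apply (at_edge u v w); [exact (fpath0 _ _ S) | exact Hw |].
    destruct S as [-> | ->]; simpl in *; lia.
  - destruct (Z.eq_dec (fst u * snd u) 0) as [E | E].
    { apply (at_edge u v w); [exact (fpathS _ _ _ _ A H) | exact Hw | exact E]. }
    destruct IH as (c & n1 & n2 & Hc & En & P1 & P2); auto.
    + exists u; apply farey_adj_sym, A.
    + destruct u as [p q], x as [r s]; unfold farey_adj in A; simpl in *.
      destruct (Z_le_gt_dec (r * s) 0) as [G | G]; [exact G | exfalso].
      destruct (mul_pos_same_sign r s G) as [[] | []];
      destruct (mul_pos_same_sign p (- q)) as [[] | []]; nia.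
    + exists c, (S n1), n2; split; [exact Hc |]; split; [lia |].
      split; [exact (fpathS _ _ _ _ A P1) | exact P2].
Qed.

(** * Logarithmic bound on distances from oo *)

Lemma nearest_multiple (p q : Z) :
  (q <> 0)%Z -> exists m, (2 * Z.abs (p - m * q) <= Z.abs q)%Z.
Proof.
  intros Hq.
  pose proof (Z.div_mod p (Z.abs q) ltac:(lia)) as E.
  pose proof (Z.mod_pos_bound p (Z.abs q) ltac:(lia)) as B.
  set (r := (p mod Z.abs q)%Z) in *; set (t := (p / Z.abs q)%Z) in *.
  assert (S : (Z.abs q = Z.sgn q * q)%Z) by lia.
  destruct (Z_le_gt_dec (2 * r) (Z.abs q)) as [H | H].
  - exists (t * Z.sgn q)%Z.
    replace (p - t * Z.sgn q * q)%Z with r by (rewrite E, S; ring). lia.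
  - exists ((t + 1) * Z.sgn q)%Z.
    replace (p - (t + 1) * Z.sgn q * q)%Z with (r - Z.abs q)%Z by (rewrite E, S; ring). lia.
Qed.

(* Nearest-integer continued fraction: each step at least halves the denominator. *)
Lemma fpath_infty_log n p q u v :
  (u * p + v * q = 1)%Z -> (Z.abs q < 2 ^ Z.of_nat n)%Z ->
  exists j, (j <= n)%nat /\ fpath v_infty (p, q) j.
Proof.
  revert p q u v; induction n as [| n IH]; intros p q u v E B.
  - simpl in B; assert (q = 0)%Z by lia; subst q.
    exists 0%nat; split; [lia |]; apply fpath0.
    assert (A : (p * u = 1)%Z) by lia; apply Z.mul_eq_1 in A.
    unfold same_vtx, v_infty; simpl; destruct A as [-> | ->]; auto.
  - destruct (Z.eq_dec q 0) as [-> | Hq].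
    + exists 0%nat; split; [lia |]; apply fpath0.
      assert (A : (p * u = 1)%Z) by lia; apply Z.mul_eq_1 in A.
      unfold same_vtx, v_infty; simpl; destruct A as [-> | ->]; auto.
    + destruct (nearest_multiple p q Hq) as [m Hm].
      (* The matrix with rows (-m, 1) and (-1, 0) sends this smaller vertex to (p, q), and sends oo
         to the integer m, a neighbour of oo. *)
      destruct (IH (- q)%Z (p - m * q)%Z (- (u * m + v))%Z u) as (j & Hj & P).
      * rewrite <- E; ring.
      * rewrite Nat2Z.inj_succ, Z.pow_succ_r in B by lia; lia.
      * exists (S j); split; [lia |].
        apply (act_fpath (mkM2 (- m) 1 (-1) 0)) in P; [| unfold SL2Z; cbn [ma mb mc md]; ring].
        unfold act in P; cbn [ma mb mc md fst snd v_infty] in P.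
        apply fpathS with ((- m * 1 + 1 * 0)%Z, (-1 * 1 + 0 * 0)%Z).
        { unfold farey_adj; cbn [fst snd v_infty]; lia. }
        match type of P with fpath _ ?w _ => replace (p, q) with w by (f_equal; ring) end.
        exact P.
Qed.

Lemma fpath_infty_exists p q u v :
  (u * p + v * q = 1)%Z -> exists j, fpath v_infty (p, q) j.
Proof.
  intros E; destruct (fpath_infty_log (Z.to_nat (Z.abs q)) p q u v E) as (j & _ & P).
  - rewrite Z2Nat.id by lia; apply Z.pow_gt_lin_r; lia.
  - exists j; exact P.
Qed.

(** * Distances along the orbit of the separating edge *)

Definition minv (f : M2) : M2 := mkM2 (md f) (- mb f) (- mc f) (ma f).

Lemma SL2Z_minv f : SL2Z f -> SL2Z (minv f).
Proof. unfold SL2Z, minv; cbn [ma mb mc md]; lia. Qed.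

Lemma mmul_minv_l f : SL2Z f -> mmul (minv f) f = mid.
Proof.
  unfold SL2Z, minv, mmul, mid; intros H; cbn [ma mb mc md]; apply M2_eq; lia.
Qed.

Lemma mmul_minv_r f : SL2Z f -> mmul f (minv f) = mid.
Proof.
  unfold SL2Z, minv, mmul, mid; intros H; cbn [ma mb mc md]; apply M2_eq; lia.
Qed.

Lemma SL2Z_mid : SL2Z mid.
Proof. reflexivity. Qed.

Lemma nonneg_mpow f j : nonneg f -> nonneg (mpow f j).
Proof.
  intros H; induction j as [| j IH]; [unfold nonneg; simpl; lia |].
  unfold nonneg, mmul in *; simpl mpow; unfold mmul; cbn [ma mb mc md]; nia.
Qed.

Definition edge_vtx (x : bool) : vtx := if x then v_infty else v_zero.

Lemma edge_vtx_adj x : exists w, farey_adj (edge_vtx x) w.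
Proof. exists (edge_vtx (negb x)); destruct x; reflexivity. Qed.

Lemma edge_vtx_cases c : c = v_infty \/ c = v_zero -> exists x, c = edge_vtx x.
Proof. intros [-> | ->]; [exists true | exists false]; reflexivity. Qed.

(** Pulled back by the inverse of [f], the path starts on the nonpositive side of {oo, 0} and ends
    on the nonnegative side, so it meets an end of that edge; its first piece is then pushed forward
    by [f]. This is the min-plus product rule for [edge_dist]. *)
Lemma fpath_mpow_split f j x y n : SL2Z f -> nonneg f ->
  fpath (edge_vtx x) (act (mpow f (S j)) (edge_vtx y)) n ->
  exists c n1 n2, n = (n1 + n2)%nat /\
    fpath (edge_vtx x) (act f (edge_vtx c)) n1 /\
    fpath (edge_vtx c) (act (mpow f j) (edge_vtx y)) n2.
Proof.
  intros Hf Hn P.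
  apply (act_fpath (minv f) _ _ _ (SL2Z_minv f Hf)) in P.
  simpl mpow in P.
  rewrite <- (act_mmul (minv f)), <- mmul_assoc, mmul_minv_l, mmul_id_l in P by exact Hf.
  destruct (fpath_split _ _ _ P) as (c & n1 & n2 & Hc & E & P1 & P2).
  - destruct (edge_vtx_adj x) as [w Hw]; exists (act (minv f) w).
    apply act_farey_adj; [exact (SL2Z_minv f Hf) | exact Hw].
  - unfold nonneg in Hn.
    destruct x; unfold edge_vtx, act, v_infty, v_zero, minv; cbn [fst snd ma mb mc md]; nia.
  - pose proof (nonneg_mpow f j Hn) as Hj; unfold nonneg in Hj.
    destruct y; unfold edge_vtx, act, v_infty, v_zero; cbn [fst snd]; nia.
  - destruct (edge_vtx_cases c Hc) as [z ->].
    exists z, n1, n2; split; [exact E |]; split; [| exact P2].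
    apply (act_fpath f _ _ _ Hf) in P1.
    rewrite <- act_mmul, mmul_minv_r, act_mid in P1 by exact Hf; exact P1.
Qed.

Lemma act_v_infty f : act f v_infty = (ma f, mc f).
Proof. unfold act, v_infty; cbn [fst snd]; f_equal; ring. Qed.

Lemma act_v_zero f : act f v_zero = (mb f, md f).
Proof. unfold act, v_zero; cbn [fst snd]; f_equal; ring. Qed.

Lemma fpath_edge_exists f x y :
  SL2Z f -> exists n, fpath (edge_vtx x) (act f (edge_vtx y)) n.
Proof.
  intros Hf; unfold SL2Z in Hf.
  assert (H : exists n, fpath v_infty (act f (edge_vtx y)) n).
  { destruct y; unfold edge_vtx; [rewrite act_v_infty | rewrite act_v_zero].
    - apply (fpath_infty_exists _ _ (md f) (- mb f)); lia.
    - apply (fpath_infty_exists _ _ (- mc f) (ma f)); lia. }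
  destruct H as [n H]; destruct x; [exists n; exact H | exists (1 + n)%nat].
  apply (fpath_cat v_zero v_infty); [apply fpath_adj; reflexivity | exact H].
Qed.

Definition edge_dist (f : M2) (x y : bool) : nat :=
  farey_dist (edge_vtx x) (act f (edge_vtx y)).

Lemma edge_dist_fpath f x y :
  SL2Z f -> fpath (edge_vtx x) (act f (edge_vtx y)) (edge_dist f x y).
Proof.
  intros Hf; destruct (fpath_edge_exists f x y Hf) as [n P].
  exact (proj1 (farey_dist_spec _ _ _ P)).
Qed.

Lemma edge_dist_le f x y n :
  fpath (edge_vtx x) (act f (edge_vtx y)) n -> (edge_dist f x y <= n)%nat.
Proof. intros P; exact (proj2 (farey_dist_spec _ _ _ P) n P). Qed.

Lemma SL2Z_mpow f j : SL2Z f -> SL2Z (mpow f j).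
Proof. intros Hf; induction j; [exact SL2Z_mid | apply SL2Z_mmul; assumption]. Qed.

(* Distances along the orbit of the separating edge multiply as min-plus powers of the 2x2 matrix
   edge_dist f, whose growth rate is its minimal cycle mean; this is twice that mean. *)
Definition double_length (f : M2) : nat :=
  Nat.min (Nat.min (2 * edge_dist f true true) (2 * edge_dist f false false))
          (edge_dist f true false + edge_dist f false true).

(** Duality for minimal cycle means: a potential [phi] makes each doubled step cost at least [h] up
    to a difference of potentials, and these differences telescope along the path. *)
Lemma edge_dist_mpow_lower f : SL2Z f -> nonneg f ->
  exists C : Z, forall j,
    (Z.of_nat j * Z.of_nat (double_length f) - C <=
     2 * Z.of_nat (edge_dist (mpow f j) true true))%Z.
Proof.
  intros Hf Hn; set (h := Z.of_nat (double_length f)).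
  (* This value makes the step from oo to 0 tight; the other three inequalities are then the three
     terms of the minimum. *)
  set (s := (2 * Z.of_nat (edge_dist f true false) - h)%Z).
  set (phi := fun x : bool => if x then 0%Z else s).
  assert (step : forall x y, (h + phi y - phi x <= 2 * Z.of_nat (edge_dist f x y))%Z).
  { intros [] []; unfold phi, s, h, double_length; lia. }
  exists (Z.abs s); intros j.
  assert (L : forall j n x y, fpath (edge_vtx x) (act (mpow f j) (edge_vtx y)) n ->
    (Z.of_nat j * h + phi y - phi x - Z.abs s <= 2 * Z.of_nat n)%Z).
  { clear j; intros j; induction j as [| j IH]; intros n x y P.
    - destruct x, y; unfold phi; lia.
    - destruct (fpath_mpow_split f j x y n Hf Hn P) as (c & n1 & n2 & -> & P1 & P2).
      apply IH in P2; apply edge_dist_le in P1; specialize (step x c); lia. }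
  specialize (L j _ _ _ (edge_dist_fpath (mpow f j) true true (SL2Z_mpow f j Hf))).
  unfold phi in L; lia.
Qed.

Lemma fpath_mpow f v n j : SL2Z f ->
  fpath v (act f v) n -> fpath v (act (mpow f j) v) (j * n).
Proof.
  intros Hf P; induction j as [| j IH].
  - simpl mpow; rewrite act_mid; apply fpath0; left; reflexivity.
  - simpl mpow; rewrite act_mmul; apply (fpath_cat _ (act f v)); [exact P |].
    apply act_fpath; assumption.
Qed.

(** Going around whichever of the three simple cycles attains the minimum gives a path of the
    required length. *)
Lemma edge_dist_mpow_upper f : SL2Z f ->
  exists C : Z, forall j,
    (2 * Z.of_nat (edge_dist (mpow f j) true true) <=
     Z.of_nat j * Z.of_nat (double_length f) + C)%Z.
Proof.
  intros Hf.
  pose proof (fun x y => edge_dist_fpath f x y Hf) as P.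
  assert (L : exists C, forall j, exists n,
    fpath (edge_vtx true) (act (mpow f j) (edge_vtx true)) n /\
    (2 * n <= j * double_length f + C)%nat).
  { assert (H : double_length f = (2 * edge_dist f true true)%nat \/
      double_length f = (2 * edge_dist f false false)%nat \/
      double_length f = (edge_dist f true false + edge_dist f false true)%nat)
      by (unfold double_length; lia).
    destruct H as [-> | [-> | ->]].
    - exists 0%nat; intros j; exists (j * edge_dist f true true)%nat.
      split; [apply fpath_mpow; auto | lia].
    (* The orbit of 0 is entered and left through one edge each, and lengths are doubled. *)
    - exists 4%nat; intros j; exists (1 + (j * edge_dist f false false + 1))%nat.
      split; [| lia].
      apply (fpath_cat _ (edge_vtx false)); [apply fpath_adj; reflexivity |].
      apply (fpath_cat _ (act (mpow f j) (edge_vtx false))).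
      + apply fpath_mpow; auto.
      + apply act_fpath; [apply SL2Z_mpow, Hf | apply fpath_adj; reflexivity].
    (* The cycle through both ends advances two powers of [f] at a time; an odd [j] costs one extra
       step from oo to its image. *)
    - exists (2 * edge_dist f true true)%nat; intros j.
      induction j as [j IH] using lt_wf_ind.
      destruct j as [| [| j]].
      + exists 0%nat; split; [| lia].
        simpl mpow; rewrite act_mid; apply fpath0; left; reflexivity.
      + exists (edge_dist f true true); split; [| lia].
        simpl mpow; rewrite mmul_id_r; apply P.
      + destruct (IH j) as (n & Q & B); [lia |].
        exists (edge_dist f true false + (edge_dist f false true + n))%nat.
        split; [| lia].
        apply (fpath_cat _ (act f (edge_vtx false))); [apply P |].
        simpl mpow; rewrite act_mmul; apply act_fpath; [exact Hf |].
        apply (fpath_cat _ (act f (edge_vtx true))); [apply P |].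
        rewrite act_mmul; apply act_fpath; assumption. }
  destruct L as [C L]; exists (Z.of_nat C); intros j.
  destruct (L j) as (n & Q & B); apply edge_dist_le in Q; lia.
Qed.

(** * The stable translation length as a half-integer *)

Lemma is_liminf_of_rate u l C :
  (forall j, (1 <= j)%nat -> Rabs (u j - l) <= C / INR j) -> is_liminf u l.
Proof.
  intros H.
  assert (L : forall eps, eps > 0 -> exists N, forall j, (j >= N)%nat ->
    l - eps < u j < l + eps).
  { intros eps He; destruct (INR_archimed eps C He) as [N HN].
    exists (S N); intros j Hj; specialize (H j ltac:(lia)).
    assert (Hp : 0 < INR j) by (apply lt_0_INR; lia).
    assert (B : C / INR j < eps).
    { apply (Rmult_lt_reg_r (INR j)); [exact Hp |].
      unfold Rdiv; rewrite Rmult_assoc, Rinv_l, Rmult_1_r by lra.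
      apply Rlt_le_trans with (INR N * eps); [lra |].
      rewrite Rmult_comm; apply Rmult_le_compat_l; [lra | apply le_INR; lia]. }
    assert (A : Rabs (u j - l) < eps) by lra.
    apply Rabs_def2 in A; lra. }
  split; intros eps He; destruct (L eps He) as [N HN].
  - exists N; intros j Hj; apply HN, Hj.
  - intros M; exists (N + M)%nat; split; [lia | apply HN; lia].
Qed.

Lemma is_liminf_le u l l' : is_liminf u l -> is_liminf u l' -> l <= l'.
Proof.
  intros [A _] [_ B]; destruct (Rle_or_lt l l') as [H | H]; [exact H | exfalso].
  destruct (A ((l - l') / 2) ltac:(lra)) as [N HN].
  destruct (B ((l - l') / 2) ltac:(lra) N) as (j & Hj & L).
  specialize (HN j Hj); lra.
Qed.

(** The lower limit is unique, so the [epsilon] choice can only be [l]. *)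
Lemma liminf_eq u l : is_liminf u l -> liminf u = l.
Proof.
  intros H; assert (K : is_liminf u (liminf u))
    by (unfold liminf; apply epsilon_spec; exists l; exact H).
  apply Rle_antisym; eapply is_liminf_le; eassumption.
Qed.

(** Twice the distance from oo to its [j]-th image stays within a constant of [j] times
    [double_length f]; dividing by 2j gives a rate of order 1/j. *)
Lemma lC_eq f : SL2Z f -> nonneg f -> lC f = INR (double_length f) / 2.
Proof.
  intros Hf Hn; apply liminf_eq.
  destruct (edge_dist_mpow_lower f Hf Hn) as [C1 L].
  destruct (edge_dist_mpow_upper f Hf) as [C2 U].
  apply (is_liminf_of_rate _ _ (IZR (Z.abs C1 + Z.abs C2) / 2)); intros j Hj.
  change (farey_dist v_infty (act (mpow f j) v_infty)) with (edge_dist (mpow f j) true true).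
  set (D := edge_dist (mpow f j) true true); set (h := double_length f).
  assert (Hp : 0 < INR j) by (apply lt_0_INR; lia).
  assert (B : Rabs (2 * INR D - INR j * INR h) <= IZR (Z.abs C1 + Z.abs C2)).
  { rewrite !INR_IZR_INZ, <- !mult_IZR, <- minus_IZR, <- abs_IZR; apply IZR_le.
    specialize (L j); specialize (U j); fold D h in L, U; lia. }
  replace (INR D / INR j - INR h / 2) with ((2 * INR D - INR j * INR h) * (/ 2 * / INR j))
    by (field; lra).
  rewrite Rabs_mult, (Rabs_right (/ 2 * / INR j)).
  2: { apply Rle_ge, Rlt_le, Rmult_lt_0_compat; [lra | apply Rinv_0_lt_compat, Hp]. }
  replace (IZR (Z.abs C1 + Z.abs C2) / 2 / INR j)
    with (IZR (Z.abs C1 + Z.abs C2) * (/ 2 * / INR j)) by (field; lra).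
  apply Rmult_le_compat_r; [| exact B].
  apply Rlt_le, Rmult_lt_0_compat; [lra | apply Rinv_0_lt_compat, Hp].
Qed.

(** The loop at oo alone bounds the minimum, and the image of oo is a/c. *)
Lemma double_length_log f n : SL2Z f -> (Z.abs (mc f) < 2 ^ Z.of_nat n)%Z ->
  (double_length f <= 2 * n)%nat.
Proof.
  intros Hf B; unfold SL2Z in Hf.
  destruct (fpath_infty_log n (ma f) (mc f) (md f) (- mb f)) as (j & Hj & P); [lia | exact B |].
  rewrite <- act_v_infty in P.
  apply (edge_dist_le f true true) in P; unfold double_length; lia.
Qed.

(** * Counting conjugacy classes by lists of representatives *)

(** Non-conjugacy is phrased by membership rather than by positions as in [is_class_count], so that
    it passes to filtered lists at once. *)
Definition independent (L : list M2) : Prop :=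
  NoDup L /\ forall x y, In x L -> In y L -> psl_conj x y -> x = y.

Definition covers (L : list M2) (P : M2 -> Prop) : Prop :=
  forall x, SL2Z x -> P x -> exists y, In y L /\ psl_conj x y.

Lemma is_class_count_intro P L :
  independent L -> (forall x, In x L -> SL2Z x /\ P x) -> covers L P ->
  is_class_count P (length L).
Proof.
  intros [ND Hi] HP Hc; exists L; repeat split; [apply HP, H | apply HP, H | | exact Hc].
  intros i j Hlt Hlt' Hne C; apply Hne.
  apply (proj1 (NoDup_nth L mid) ND); try assumption.
  apply Hi; try apply nth_In; assumption.
Qed.

Lemma is_class_count_elim P N : is_class_count P N ->
  exists L, length L = N /\ independent L /\
    (forall x, In x L -> SL2Z x /\ P x) /\ covers L P.
Proof.
  intros (L & HN & HP & Hi & Hc); exists L; split; [exact HN |]; subst N.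
  split; [| split; [exact HP | exact Hc]].
  assert (Hi' : forall i j, (i < length L)%nat -> (j < length L)%nat ->
    psl_conj (nth i L mid) (nth j L mid) -> i = j).
  { intros i j Hlt Hlt' C; destruct (Nat.eq_dec i j) as [E | E]; [exact E |].
    destruct (Hi i j Hlt Hlt' E C). }
  split.
  - apply (NoDup_nth L mid); intros i j Hlt Hlt' E; apply Hi'; try assumption.
    rewrite E; apply psl_conj_refl.
  - intros x y Hx Hy C.
    apply (In_nth _ _ mid) in Hx as (i & Hlt & <-).
    apply (In_nth _ _ mid) in Hy as (j & Hlt' & <-).
    rewrite (Hi' i j Hlt Hlt' C); reflexivity.
Qed.

(** Choosing a conjugate in [L2] for each member of [L1] is injective, since members with the same
    choice are conjugate to each other. *)
Lemma independent_length_le L1 L2 :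
  independent L1 -> (forall x, In x L1 -> exists y, In y L2 /\ psl_conj x y) ->
  (length L1 <= length L2)%nat.
Proof.
  intros [ND Hi] H.
  set (g := fun x => epsilon (inhabits mid) (fun y => In y L2 /\ psl_conj x y)).
  assert (Hg : forall x, In x L1 -> In (g x) L2 /\ psl_conj x (g x)).
  { intros x Hx; unfold g; apply epsilon_spec, H, Hx. }
  rewrite <- (length_map g L1); apply NoDup_incl_length.
  - apply NoDup_map_NoDup_ForallPairs; [| exact ND].
    intros x y Hx Hy E; apply Hi; try assumption.
    apply (psl_conj_trans _ (g x)); [apply Hg, Hx |].
    rewrite E; apply psl_conj_sym, Hg, Hy.
  - intros z Hz; apply in_map_iff in Hz as (x & <- & Hx); apply Hg, Hx.
Qed.

(** Going through [F], one [P]-element conjugate to the current entry is added when its class is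
    still missing. The representatives come from [P] itself and not from [F], because [P] may fail
    to be invariant under conjugacy, as with [nonneg]. *)
Lemma representatives_exist (P : M2 -> Prop) (F : list M2) :
  exists L, independent L /\ (forall x, In x L -> P x) /\
    forall x y, P x -> In y F -> psl_conj x y -> exists z, In z L /\ psl_conj x z.
Proof.
  induction F as [| a F (L & [ND Hi] & HP & Hc)].
  { exists nil; split; [split; [constructor |] |]; simpl; tauto. }
  destruct (classic (exists x, P x /\ psl_conj x a /\
    forall z, In z L -> ~ psl_conj x z)) as [(x & Px & Ca & Hn) | Hno].
  - exists (x :: L); split; [split |].
    + constructor; [| exact ND].
      intros Hx; exact (Hn x Hx (psl_conj_refl x)).
    + intros u v [-> | Hu] [-> | Hv] C; auto; exfalso.
      * exact (Hn v Hv C).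
      * exact (Hn u Hu (psl_conj_sym _ _ C)).
    + split; [intros u [<- | Hu]; auto |].
      intros u y Pu [<- | Hy] C.
      * exists x; split; [left; reflexivity |].
        exact (psl_conj_trans _ _ _ C (psl_conj_sym _ _ Ca)).
      * destruct (Hc u y Pu Hy C) as (z & Hz & Cz); exists z; split; [right |]; assumption.
  - exists L; split; [split; assumption | split; [exact HP |]].
    intros u y Pu [<- | Hy] C; [| exact (Hc u y Pu Hy C)].
    apply NNPP; intros Hn; apply Hno; exists u; split; [exact Pu | split; [exact C |]].
    intros z Hz Cz; apply Hn; exists z; split; assumption.
Qed.

(** * Finiteness of the set of classes of bounded dilatation *)

Definition box (B : nat) : list M2 :=
  let r := map Z.of_nat (seq 0 (S B)) in
  map (fun t => mkM2 (fst (fst (fst t))) (snd (fst (fst t))) (snd (fst t)) (snd t))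
    (list_prod (list_prod (list_prod r r) r) r).

Lemma in_box B f : nonneg f ->
  (ma f <= Z.of_nat B /\ mb f <= Z.of_nat B /\ mc f <= Z.of_nat B /\ md f <= Z.of_nat B)%Z ->
  In f (box B).
Proof.
  destruct f as [a b c d]; unfold nonneg, box; cbn [ma mb mc md]; intros H H'.
  assert (R : forall z, (0 <= z <= Z.of_nat B)%Z -> In z (map Z.of_nat (seq 0 (S B)))).
  { intros z Hz; apply in_map_iff; exists (Z.to_nat z); split; [lia | apply in_seq; lia]. }
  apply in_map_iff; exists (((a, b), c), d); split; [reflexivity |].
  repeat apply in_prod; apply R; lia.
Qed.

(** The diagonal entries are at most the trace, and bc = ad - 1 < T^2 with b and c both positive. *)
Lemma nonneg_entries_bound f T : SL2Z f -> hyperbolic f -> nonneg f ->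
  (Z.abs (mtr f) <= T)%Z ->
  (ma f <= T /\ md f <= T /\ mb f < T * T /\ mc f < T * T)%Z.
Proof.
  unfold SL2Z, hyperbolic, nonneg, mtr; intros Hd Hh (Ha & Hb & Hc & Hd') HT.
  rewrite Z.abs_eq in * by lia.
  assert (A : (ma f * md f <= T * T)%Z) by (apply Z.mul_le_mono_nonneg; lia).
  assert (B : (mb f * mc f <> 0)%Z).
  { intros E; assert (K : (ma f * md f = 1)%Z) by lia.
    apply Z.mul_eq_1 in K as K'; destruct K' as [K' | K']; rewrite K' in *; lia. }
  assert (mb f <> 0 /\ mc f <> 0)%Z by (split; intros E; rewrite E in B; lia).
  assert (mb f <= mb f * mc f)%Z by nia.
  assert (mc f <= mb f * mc f)%Z by nia.
  lia.
Qed.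

Lemma abs_mtr_le_dilatation f : IZR (Z.abs (mtr f)) <= 2 * dilatation f.
Proof.
  unfold dilatation; pose proof (sqrt_pos (IZR (mtr f * mtr f - 4))); lra.
Qed.

Lemma dilatation_lt_abs_mtr f : hyperbolic f -> dilatation f < IZR (Z.abs (mtr f)).
Proof.
  unfold hyperbolic, dilatation; intros H; set (t := Z.abs (mtr f)) in *.
  assert (Ht : 0 <= IZR t) by (apply IZR_le; lia).
  assert (S : sqrt (IZR (mtr f * mtr f - 4)) < IZR t).
  { rewrite <- (sqrt_square (IZR t)) by exact Ht.
    rewrite <- mult_IZR; unfold t; rewrite <- Z.abs_mul.
    apply sqrt_lt_1; apply IZR_le || apply IZR_lt; nia. }
  lra.
Qed.

Lemma hyperbolic_conj_box f T : SL2Z f -> hyperbolic f ->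
  (Z.abs (mtr f) <= Z.of_nat T)%Z ->
  exists f', psl_conj f f' /\ nonneg f' /\ In f' (box (T * T)).
Proof.
  intros Hf Hh HT; destruct (hyperbolic_conj_nonneg f Hf Hh) as (f' & C & Hn).
  exists f'; split; [exact C | split; [exact Hn |]]; apply in_box; [exact Hn |].
  rewrite <- (psl_conj_abs_mtr _ _ C) in HT.
  pose proof (nonneg_entries_bound f' _ (psl_conj_SL2Z _ _ C Hf)
    (psl_conj_hyperbolic _ _ C Hh) Hn HT).
  nia.
Qed.

Lemma abs_mtr_bounded r :
  exists T, forall f, dilatation f < r -> (Z.abs (mtr f) <= Z.of_nat T)%Z.
Proof.
  destruct (INR_unbounded (2 * r)) as [T HT]; exists T; intros f Hf.
  pose proof (abs_mtr_le_dilatation f); rewrite INR_IZR_INZ in HT.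
  apply le_IZR; lra.
Qed.

(** The [epsilon] in [class_count] is meaningful once a finite system of representatives exists;
    bounded dilatation bounds the trace, and then every class meets a fixed box. *)
Lemma class_count_spec P r :
  (forall f, P f -> hyperbolic f /\ dilatation f < r) ->
  is_class_count P (class_count P).
Proof.
  intros HP; unfold class_count; apply epsilon_spec.
  destruct (abs_mtr_bounded r) as [T HT].
  destruct (representatives_exist (fun x => SL2Z x /\ P x) (box (T * T)))
    as (L & Hi & HL & Hc).
  exists (length L); apply is_class_count_intro; [exact Hi | exact HL |].
  intros x Sx Px; destruct (HP x Px) as [Hh Hd].
  destruct (hyperbolic_conj_box x T Sx Hh (HT x Hd)) as (y & C & _ & Hy).
  exact (Hc x y (conj Sx Px) Hy C).
Qed.

(** Representatives are taken nonnegative so that [lC_eq] applies to each of them. *)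
Lemma class_count_nonneg_representatives r :
  exists L, independent L /\
    (forall x, In x L -> SL2Z x /\ nonneg x /\ hyperbolic x /\ dilatation x < r) /\
    covers L (fun f => hyperbolic f /\ dilatation f < r).
Proof.
  destruct (abs_mtr_bounded r) as [T HT].
  destruct (representatives_exist
    (fun x => SL2Z x /\ nonneg x /\ hyperbolic x /\ dilatation x < r) (box (T * T)))
    as (L & Hi & HL & Hc).
  exists L; split; [exact Hi | split; [exact HL |]].
  intros x Sx [Hh Hd].
  destruct (hyperbolic_conj_box x T Sx Hh (HT x Hd)) as (y & C & Hn & Hy).
  destruct (Hc y y) as (z & Hz & Cz); [| exact Hy | apply psl_conj_refl |].
  - split; [exact (psl_conj_SL2Z _ _ C Sx) | split; [exact Hn |]].
    split; [exact (psl_conj_hyperbolic _ _ C Hh) |].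
    rewrite (psl_conj_dilatation _ _ C); exact Hd.
  - exists z; split; [exact Hz | exact (psl_conj_trans _ _ _ C Cz)].
Qed.

Lemma independent_le_class_count P r L :
  (forall f, P f -> hyperbolic f /\ dilatation f < r) ->
  independent L -> (forall x, In x L -> SL2Z x /\ P x) ->
  (length L <= class_count P)%nat.
Proof.
  intros HP Hi HL.
  destruct (is_class_count_elim _ _ (class_count_spec P r HP)) as (L' & <- & _ & _ & Hc).
  apply independent_length_le; [exact Hi |].
  intros x Hx; apply Hc; apply HL, Hx.
Qed.

Lemma class_count_le_covers P r L :
  (forall f, P f -> hyperbolic f /\ dilatation f < r) ->
  covers L P -> (class_count P <= length L)%nat.
Proof.
  intros HP Hc.
  destruct (is_class_count_elim _ _ (class_count_spec P r HP)) as (L' & <- & Hi & HL & _).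
  apply independent_length_le; [exact Hi |].
  intros x Hx; apply Hc; apply HL, Hx.
Qed.

Lemma independent_filter p L : independent L -> independent (filter p L).
Proof.
  intros [ND Hi]; split; [apply NoDup_filter, ND |].
  intros x y Hx Hy; apply filter_In in Hx as [Hx _]; apply filter_In in Hy as [Hy _].
  apply Hi; assumption.
Qed.

(** * Few rare classes among many *)

Lemma length_le_fibers (A : Type) (h : A -> nat) (k H : nat) (l : list A) :
  (forall x, In x l -> (h x < H)%nat) ->
  (forall v, (length (filter (fun x => Nat.eqb (h x) v) l) <= k)%nat) ->
  (length l <= k * H)%nat.
Proof.
  revert l; induction H as [| H IH]; intros l Hb Hf.
  - destruct l as [| a l]; [simpl; lia | specialize (Hb a (or_introl eq_refl)); lia].
  - rewrite <- (filter_length (fun x => Nat.eqb (h x) H) l).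
    specialize (IH (filter (fun x => negb (Nat.eqb (h x) H)) l)).
    pose proof (Hf H).
    enough (length (filter (fun x => negb (Nat.eqb (h x) H)) l) <= k * H)%nat by lia.
    apply IH.
    + intros x Hx; apply filter_In in Hx as [Hx E]; specialize (Hb x Hx).
      destruct (Nat.eqb_spec (h x) H); [discriminate | lia].
    + intros v; apply Nat.le_trans with (2 := Hf v).
      clear; induction l as [| a l IHl]; simpl; [lia |].
      destruct (Nat.eqb (h a) H), (Nat.eqb (h a) v) eqn:E; simpl; rewrite ?E; simpl; lia.
Qed.

(** Members with equal [double_length] have equal [lC], so a fibre is at most as long as [m_f] of
    any of its members, which is below [k]; the number of fibres is logarithmic in [r]. *)
Lemma few_rare_classes r n k L :
  r <= 2 ^ S n -> independent L ->
  (forall x, In x L -> SL2Z x /\ nonneg x /\ hyperbolic x /\ dilatation x < r) ->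
  (length (filter (fun x => Nat.ltb (m_f x r) k) L) <= k * (4 * n + 9))%nat.
Proof.
  intros Hr Hi HL; apply (length_le_fibers _ double_length).
  - intros x Hx; apply filter_In in Hx as [Hx _].
    destruct (HL x Hx) as (Sx & Nx & Hh & Hd).
    (* Here |tr| <= 2 ^ (n + 2), so the entry c is below 2 ^ (2n + 4); the values 0 to 4n + 8
       account for the factor 4n + 9. *)
    assert (B : (double_length x <= 2 * (2 * n + 4))%nat); [| lia].
    apply double_length_log; [exact Sx |].
    assert (T : (Z.abs (mtr x) <= 2 ^ (Z.of_nat n + 2))%Z).
    { replace (Z.of_nat n + 2)%Z with (Z.of_nat (S (S n))) by lia.
      apply le_IZR; rewrite <- pow_IZR.
      pose proof (abs_mtr_le_dilatation x); simpl in *; lra. }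
    pose proof (nonneg_entries_bound x _ Sx Hh Nx T) as E.
    rewrite <- Z.pow_add_r in E by lia.
    replace (Z.of_nat (2 * n + 4)) with (Z.of_nat n + 2 + (Z.of_nat n + 2))%Z by lia.
    unfold nonneg in Nx; lia.
  - intros v; set (bad := filter _ L).
    destruct (filter (fun x => Nat.eqb (double_length x) v) bad) as [| x0 l] eqn:E;
      [simpl; lia |].
    assert (Hx0 : In x0 (filter (fun x => Nat.eqb (double_length x) v) bad))
      by (rewrite E; left; reflexivity).
    rewrite <- E; clear l E.
    apply filter_In in Hx0 as [Hx0 E0]; apply Nat.eqb_eq in E0.
    apply filter_In in Hx0 as [Hx0 B0]; apply Nat.ltb_lt in B0.
    apply Nat.lt_le_incl, Nat.le_lt_trans with (2 := B0).
    unfold m_f; apply (independent_le_class_count _ r).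
    + tauto.
    + apply independent_filter, independent_filter, Hi.
    + intros x Hx; apply filter_In in Hx as [Hx Ex]; apply Nat.eqb_eq in Ex.
      apply filter_In in Hx as [Hx _].
      destruct (HL x Hx) as (Sx & Nx & Hh & Hd).
      destruct (HL x0 Hx0) as (Sx0 & Nx0 & _ & _).
      rewrite !lC_eq, Ex, E0 by assumption; auto.
Qed.

(** The matrices with rows (t, -1) and (1, 0), for t from 3 to K + 2, have distinct traces t and
    dilatation below t. *)
Lemma class_count_lower r K : INR (K + 2) <= r ->
  (K <= class_count (fun f => hyperbolic f /\ (dilatation f < r)%R))%nat.
Proof.
  intros Hr; set (g := fun t => mkM2 (Z.of_nat t) (-1) 1 0).
  assert (Hm : forall t, Z.abs (mtr (g t)) = Z.of_nat t).
  { intros t; unfold mtr, g; cbn [ma md]; lia. }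
  rewrite <- (length_seq K 3), <- (length_map g).
  apply (independent_le_class_count _ r); [auto | split |].
  - apply NoDup_map_NoDup_ForallPairs; [| apply seq_NoDup].
    intros s t _ _ E; apply (f_equal ma) in E; simpl in E; lia.
  - intros x y Hx Hy C.
    apply in_map_iff in Hx as (s & <- & _); apply in_map_iff in Hy as (t & <- & _).
    apply psl_conj_abs_mtr in C; rewrite !Hm in C; f_equal; lia.
  - intros x Hx; apply in_map_iff in Hx as (t & <- & Ht); apply in_seq in Ht.
    assert (Hh : hyperbolic (g t)) by (unfold hyperbolic; rewrite Hm; lia).
    split; [unfold SL2Z, g; cbn [ma mb mc md]; lia | split; [exact Hh |]].
    apply Rlt_le_trans with (1 := dilatation_lt_abs_mtr _ Hh).
    rewrite Hm, <- INR_IZR_INZ; apply Rle_trans with (2 := Hr), le_INR; lia.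
Qed.

(** One list of nonnegative representatives has length [N]; it splits into the rare part, bounded by
    [few_rare_classes], and the frequent part, counted by [N']. *)
Lemma class_count_frequent_bounds r n k : 2 ^ n <= r <= 2 ^ S n ->
  let N := class_count (fun f => hyperbolic f /\ dilatation f < r) in
  let N' := class_count (fun f => hyperbolic f /\ dilatation f < r /\ (k <= m_f f r)%nat) in
  (N' <= N /\ N <= N' + k * (4 * n + 9) /\ 2 ^ n <= N + 2)%nat.
Proof.
  intros [Hr1 Hr2] N N'.
  destruct (class_count_nonneg_representatives r) as (L & Hi & HL & Hc).
  assert (HN : (N <= length L)%nat) by (apply (class_count_le_covers _ r); tauto).
  assert (HN' : (length L <= N)%nat).
  { apply (independent_le_class_count _ r); [tauto | exact Hi |].
    intros x Hx; specialize (HL x Hx); tauto. }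
  repeat split.
  - apply Nat.le_trans with (2 := HN'), (class_count_le_covers _ r); [tauto |].
    intros x Sx Px; apply Hc; tauto.
  - pose proof (few_rare_classes r n k L Hr2 Hi HL) as B.
    rewrite <- (filter_length (fun x => Nat.ltb (m_f x r) k) L) in HN.
    enough (length (filter (fun x => negb (Nat.ltb (m_f x r) k)) L) <= N')%nat by lia.
    apply (independent_le_class_count _ r); [tauto | apply independent_filter, Hi |].
    intros x Hx; apply filter_In in Hx as [Hx E]; specialize (HL x Hx).
    destruct (Nat.ltb_spec (m_f x r) k) as [F | F]; [discriminate | tauto].
  (* Subtraction on naturals truncates, so the case 2 ^ n < 2 is treated apart. *)
  - destruct (Nat.le_gt_cases 2 (2 ^ n)) as [G | G]; [| lia].
    pose proof (class_count_lower r (2 ^ n - 2)) as B.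
    fold N in B; enough (2 ^ n - 2 <= N)%nat by lia; apply B.
    replace (2 ^ n - 2 + 2)%nat with (2 ^ n)%nat by lia.
    rewrite pow_INR; exact Hr1.
Qed.

(** * The limit: exponential growth against a linear error *)

Lemma square_le_pow2 n : (4 <= n)%nat -> (n * n <= 2 ^ n)%nat.
Proof. induction 1 as [| n H IH]; [simpl; lia | rewrite Nat.pow_succ_r'; nia]. Qed.

Lemma dyadic_scale r : 1 <= r -> exists n, 2 ^ n <= r <= 2 ^ S n.
Proof.
  intros Hr; destruct (Pow_x_infinity 2 ltac:(rewrite Rabs_right; lra) r) as [m Hm].
  specialize (Hm m (Nat.le_refl m)); rewrite Rabs_right in Hm
    by (apply Rle_ge, pow_le; lra).
  induction m as [| m IH].
  - exists 0%nat; simpl in *; lra.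
  - destruct (Rle_or_lt (2 ^ m) r) as [H | H]; [exists m; lra | apply IH; lra].
Qed.

Theorem mainTheorem16 : forall k : nat, (1 <= k)%nat ->
  forall eps : R, eps > 0 -> exists R0 : R, R0 > 1 /\
    forall Rr : R, Rr > R0 ->
      Rabs (INR (class_count (fun f => hyperbolic f /\ dilatation f < Rr /\ (k <= m_f f Rr)%nat))
            / INR (class_count (fun f => hyperbolic f /\ dilatation f < Rr)) - 1) < eps.
Proof.
  intros k _ eps He.
  (* At most 13 k n classes are rare, as 4n + 9 <= 13n, and A n <= 2N; the rare proportion is thus
     at most 26 k / A < eps. *)
  destruct (INR_archimed eps (26 * INR k) He) as [A HA].
  (* The summand 4 makes [square_le_pow2] available, and A <= n then gives the bound on A n. *)
  set (n0 := (A + 4)%nat); exists (2 ^ n0); split.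
  { apply Rlt_pow_R1; [lra | unfold n0; lia]. }
  intros r Hr.
  assert (H1 : 1 <= 2 ^ n0) by (apply pow_R1_Rle; lra).
  destruct (dyadic_scale r ltac:(lra)) as [n Hn].
  assert (Hn0 : (n0 <= n)%nat).
  { destruct (Nat.le_gt_cases n0 n) as [H | H]; [exact H | exfalso].
    assert (2 ^ S n <= 2 ^ n0) by (apply Rle_pow; [lra | lia]); lra. }
  destruct (class_count_frequent_bounds r n k Hn) as (B1 & B2 & B3).
  set (N := class_count (fun f => hyperbolic f /\ dilatation f < r)) in *.
  set (N' := class_count (fun f => hyperbolic f /\ dilatation f < r /\ (k <= m_f f r)%nat)) in *.
  pose proof (square_le_pow2 n ltac:(unfold n0 in Hn0; lia)) as Q.
  assert (C1 : (A * n <= 2 * N)%nat) by (unfold n0 in Hn0; nia).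
  assert (C2 : (n <= 2 * N)%nat) by (unfold n0 in Hn0; nia).
  assert (C3 : (N <= N' + 13 * k * n)%nat) by (unfold n0 in Hn0; nia).
  assert (HNpos : 0 < INR N) by (apply lt_0_INR; unfold n0 in Hn0; lia).
  assert (Hnpos : 0 < INR n) by (apply lt_0_INR; unfold n0 in Hn0; lia).
  apply le_INR in B1, C1, C3; rewrite ?plus_INR, ?mult_INR in *.
  replace (INR 2) with 2 in * by (simpl; lra).
  replace (INR 13) with 13 in * by (simpl; lra).
  replace (INR N' / INR N - 1) with (- ((INR N - INR N') / INR N)) by (field; lra).
  rewrite Rabs_Ropp, Rabs_right.
  2: { apply Rle_ge; unfold Rdiv; apply Rmult_le_pos; [lra |].
       apply Rlt_le, Rinv_0_lt_compat, HNpos. }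
  apply (Rmult_lt_reg_r (INR N)); [exact HNpos |].
  unfold Rdiv; rewrite Rmult_assoc, Rinv_l, Rmult_1_r by lra.
  assert (26 * INR k * INR n < INR A * eps * INR n) by (apply Rmult_lt_compat_r; lra).
  assert (eps * (INR A * INR n) <= eps * (2 * INR N)) by (apply Rmult_le_compat_l; lra).
  lra.
Qed.
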